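(* For every instance $(G,c,D,r)$ with $m=|D|$, the MV-mTSP$_0$ with arbitrary tours (P7) and the MV-mTSP$_0$ with disjoint tours (P8) have the same optimal value: $\mathsf{OPT}_{\mathrm{P7}}=\mathsf{OPT}_{\mathrm{P8}}$.
   Context: Instance: a finite vertex set $V$; $G=(V,E)$ is the complete undirected graph on $V$, including a self-loop $vv$ at each $v$; symmetric costs $c(uv)\geq 0$ (self-loop costs $c(vv)$ are not assumed to be zero) that are metric: $c(uw)\leq c(uv)+c(vw)$ for all $u,v,w\in V$, and $c(vv)\leq 2\min_{u\in V\setminus\{v\}}c(uv)$ for all $v\in V$; a set of depots $D=\{d_1,\dots,d_m\}\subseteq V$, where $m=|D|\geq 1$ is the number of agents and $d_i$ is the depot of agent $i$; $\overline V=V\setminus D$; requests $r:\overline V\to\mathbb{Z}_{\geq 1}$. Depots have no requests. A multigraph is a multiset $X$ of edges (self-loops allowed) on $V$; $\operatorname{cost}(X)=\sum_{uv} x(uv)c(uv)$, where $x(uv)$ is the multiplicity of $uv$ in $X$. The degree $\dot\delta_X(v)$ counts each copy of the self-loop $vv$ twice. An MVTSP tour is a connected multigraph in which every degree is even; a multigraph with even degrees visits $v$ exactly $\dot\delta_X(v)/2$ times. Each agent's tour contains exactly one depot, namely the agent's own; an agent's tour is empty if it is just the isolated depot with no city visited. Both problems ask for a minimum-cost multigraph $X$ visiting each $v\in\overline V$ exactly $r(v)$ times (depots may be visited any number of times, including zero), such that: (P7) the edge multiset of $X$ can be decomposed into at most $m$ not necessarily vertex-disjoint MVTSP tours, each containing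 exactly one depot, different tours belonging to different depots; (P8) $X$ has at most $m$ connected components (isolated depots being empty tours), each of them an MVTSP tour containing exactly one depot. $\mathsf{OPT}_{\mathrm{P}i}$ denotes the minimum cost for problem P$i$. *)

(* Defs.v *)
From mathcomp Require Import all_boot all_order all_algebra.

Set Implicit Arguments.
Unset Strict Implicit.
Unset Printing Implicit Defensive.

Import Order.TTheory GRing.Theory Num.Theory.
Local Open Scope ring_scope.

(* Edges of the complete graph on V with self-loops: the vertex set of an edge
   has two elements, or one for a self-loop. *)
Definition edge (V : finType) := {e : {set V} | (0 < #|e| <= 2)%N}.

Lemma edge_subproof (V : finType) (u v : V) : (0 < #|[set u; v]| <= 2)%N.
Proof. by rewrite cards2; case: (u != v). Qed.

Definition mkedge (V : finType) (u v : V) : edge V :=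
  exist _ [set u; v] (edge_subproof u v).

(* Multisets of edges, given by their multiplicities. *)
Notation multigraph V := {ffun edge V -> nat}.

Section Multigraphs.
Variable V : finType.
Implicit Types (X : multigraph V) (S D : {set V}) (u v : V).

Definition cost (R : realFieldType) (c : edge V -> R) X : R :=
  \sum_(e : edge V) (X e)%:R * c e.

(* Each copy of the self-loop at v counts twice. *)
Definition degree X v : nat :=
  (\sum_(e : edge V | v \in val e) X e * (if e == mkedge v v then 2 else 1))%N.

(* X visits v exactly (degree X v) / 2 times; the degree is required even. *)
Definition visits X v (k : nat) : Prop := degree X v = k.*2.

Definition adj X : rel V := fun u v => (0 < X (mkedge u v))%N.

(* (S, X) is an MVTSP tour: a connected multigraph on the vertex set S in which
   every degree is even. The vertex set is explicit because the empty tour of a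
   depot d is the isolated vertex d: S = [set d] with no edges. *)
Definition MVTSP_tour S X : Prop :=
  [/\ S != set0,
      forall e : edge V, (0 < X e)%N -> val e \subset S,
      {in S &, forall u v, connect (adj X) u v}
    & forall v, ~~ odd (degree X v)].

(* Isolated vertices of V are components. *)
Definition components X : {set {set V}} :=
  equivalence_partition (connect (adj X)) [set: V].

Definition induced X S : multigraph V :=
  [ffun e : edge V => if val e \subset S then X e else 0%N].

(* Only the values of r outside D matter: depots have no requests. *)
Definition meets_requests D (r : V -> nat) X : Prop :=
  forall v, v \notin D -> visits X v (r v).

Definition P7_feasible D (r : V -> nat) X : Prop :=
  meets_requests D r X /\
  exists (k : nat) (S : 'I_k -> {set V}) (T : 'I_k -> multigraph V)
         (d : 'I_k -> V),
    [/\ (k <= #|D|)%N,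
        forall i, MVTSP_tour (S i) (T i),
        forall i, S i :&: D = [set d i],
        injective d
      & forall e : edge V, X e = (\sum_i T i e)%N].

Definition P8_feasible D (r : V -> nat) X : Prop :=
  [/\ meets_requests D r X,
      (#|components X| <= #|D|)%N
    & forall S, S \in components X ->
        MVTSP_tour S (induced X S) /\ #|S :&: D| = 1%N].

Definition is_minimum_cost (R : realFieldType) (c : edge V -> R)
    (feasible : multigraph V -> Prop) (opt : R) : Prop :=
  (exists2 X, feasible X & cost c X = opt) /\
  (forall X, feasible X -> opt <= cost c X).

End Multigraphs.

(* Main.v *)
(* An optimal solution of either problem may be sought among the even
   multigraphs that meet the requests and in which every vertex is connected to
   a depot: feasibility for P7 implies these conditions, and P8 implies P7.
   Conversely, such a multigraph is by Euler's theorem a sum of vertex-disjoint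
   closed walks, each through a depot. Starting each walk at one of its depots
   and skipping all further depot visits preserves the visits to the cities, does
   not increase the cost by the triangle inequality, and leaves exactly one depot
   per component. The resulting multiplicities are bounded, so only finitely many
   candidates remain and the minimum is attained. *)
Require Import Defs.
From mathcomp Require Import all_boot all_order all_algebra.

Import Order.TTheory GRing.Theory Num.Theory.
Local Open Scope ring_scope.

Set Implicit Arguments.
Unset Strict Implicit.
Unset Printing Implicit Defensive.

Section Multigraphs.
Variable V : finType.
Implicit Types (X Y Z : multigraph V) (S : {set V}) (u v x y z : V).
Implicit Types (p q : seq V) (s t : seq (V * V)).
Local Open Scope nat_scope.

(** * Edges, adjacency and degrees *)

Lemma mkedgeC u v : mkedge u v = mkedge v u.
Proof. by apply: val_inj; rewrite /= setUC. Qed.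

Lemma edgeP (e : edge V) : exists u v, e = mkedge u v.
Proof.
case: e => A hA.
have /orP [/cards1P [x defA]|/cards2P [x [y [_ defA]]]] : (#|A| == 1) || (#|A| == 2).
- by move: (hA); case: #|A| => [|[|[|]]].
- by exists x, x; apply: val_inj; rewrite /= setUid.
- by exists x, y; apply: val_inj.
Qed.

Lemma edge_at (e : edge V) v : v \in val e -> exists z, e = mkedge v z.
Proof.
have [x [y ->]] := edgeP e; rewrite /= !inE.
by case/orP => /eqP ->; [exists y | exists x; rewrite mkedgeC].
Qed.

Lemma eq_mkedge x y u v :
  (mkedge x y == mkedge u v) =
  ((x == u) && (y == v)) || ((x == v) && (y == u)).
Proof.
apply/eqP/idP => [/(congr1 val) /= /setP eqA|]; last first.
  by case/orP => /andP [/eqP -> /eqP ->] //; rewrite mkedgeC.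
(* Comparing memberships of the four end points leaves a Boolean case check. *)
have := (eqA x, eqA y, eqA u, eqA v); rewrite !inE !eqxx /= !orbT /=.
rewrite (eq_sym u x) (eq_sym u y) (eq_sym v x) (eq_sym v y).
by case: (x == u); case: (x == v); case: (y == u); case: (y == v) => -[[[]]].
Qed.

Lemma adj_sym X : symmetric (adj X).
Proof. by move=> u v; rewrite /adj mkedgeC. Qed.

Lemma connect_adjC X u v : connect (adj X) u v = connect (adj X) v u.
Proof. exact: (fingraph.sym_connect_sym (adj_sym X)). Qed.

Lemma degree_sum (I : finType) X (T : I -> multigraph V) v :
  (forall e, X e = \sum_i T i e) -> degree X v = \sum_i degree (T i) v.
Proof.
move=> eqX; rewrite /degree exchange_big /=; apply: eq_bigr => e _.
by rewrite eqX big_distrl.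
Qed.

Lemma degreeD X Y Z v :
  (forall e, X e = Y e + Z e) -> degree X v = degree Y v + degree Z v.
Proof.
move=> eqX; rewrite /degree -big_split /=; apply: eq_bigr => e _.
by rewrite eqX mulnDl.
Qed.

Lemma leq_degree X (e : edge V) v : v \in val e -> X e <= degree X v.
Proof.
move=> ve; rewrite /degree (bigD1 e) //=; apply: leq_trans (leq_addr _ _).
by case: ifP => _; rewrite ?muln1 // leq_pmulr.
Qed.

Lemma degree_gt0 X v : 0 < degree X v -> exists2 e : edge V, v \in val e & 0 < X e.
Proof.
rewrite lt0n /degree sum_nat_eq0 => /forall_inPn [e ve].
by rewrite muln_eq0 negb_or -lt0n => /andP [Xe _]; exists e.
Qed.

(** * Connected components *)

Lemma mem_components X S :
  S \in components X -> exists2 x, x \in S &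
    forall y, (y \in S) = connect (adj X) x y.
Proof.
case/imsetP => x _ ->; exists x; first by rewrite !inE connect0.
by move=> y; rewrite !inE.
Qed.

Lemma components_partition X : partition (components X) [set: V].
Proof.
apply: equivalence_partitionP => x y z _ _ _; split; first exact: connect0.
by move=> xy; apply/idP/idP; apply: connect_trans; rewrite // connect_adjC.
Qed.

Lemma component_edge X S u v :
  S \in components X -> 0 < X (mkedge u v) -> (u \in S) = (v \in S).
Proof.
case/mem_components => x _ defS uv; have uv' : adj X u v by [].
rewrite !defS; apply/idP/idP => /connect_trans; apply; rewrite ?connect1 //.
by rewrite adj_sym.
Qed.

(** No edge of [X] leaves a component, so restricting to [S] keeps every edge at a vertex of [S]:
    paths and degrees survive there, while degrees outside become 0. *)
Lemma component_tour X S :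
  (forall v, ~~ odd (degree X v)) -> S \in components X ->
  MVTSP_tour S (induced X S).
Proof.
move=> evenX SX; have [x xS defS] := mem_components SX; split.
- by apply/set0Pn; exists x.
- by move=> e; rewrite ffunE; case: ifP.
- move=> u v uS vS; have : connect (adj X) u v.
    by apply: (@connect_trans _ _ x); rewrite -?defS // connect_adjC -defS.
  case/connectP => p; elim: p u uS => [|z p IH] u uS /=.
    by move=> _ ->; apply: connect0.
  case/andP => uz pz lastv; have zS : z \in S by rewrite -(component_edge SX uz).
  apply: connect_trans (IH _ zS pz lastv); apply: connect1.
  rewrite /adj ffunE (_ : _ \subset S) //.
  by apply/subsetP => w; rewrite !inE => /orP [] /eqP ->.
- move=> v; have [vS|vS] := boolP (v \in S); last first.
    rewrite /degree big1 // => e ve; rewrite ffunE.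
    by case: ifP => // /subsetP /(_ _ ve); rewrite (negbTE vS).
  rewrite (_ : degree _ v = degree X v) //; apply: eq_bigr => e /edge_at [z ->].
  rewrite ffunE; case: ifPn => // nsub; congr (_ * _); apply/esym/eqP.
  rewrite -leqn0 leqNgt; apply: contra nsub => vz.
  apply/subsetP => w; rewrite !inE => /orP [] /eqP -> //.
  by rewrite -(component_edge SX vz).
Qed.

(** * Multigraphs of edge lists, and walks *)

Definition mg s : multigraph V :=
  [ffun e => count (fun a => mkedge a.1 a.2 == e) s].

Lemma mg_cat s t e : mg (s ++ t) e = mg s e + mg t e.
Proof. by rewrite !ffunE count_cat. Qed.

Lemma perm_mg s t : perm_eq s t -> mg s = mg t.
Proof. by move=> /permP st; apply/ffunP => e; rewrite !ffunE st. Qed.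

(** For a loop at [v] both indicators are 1, matching the weight 2 in [degree]. *)
Lemma degree_edge x y v : degree (mg [:: (x, y)]) v = (x == v) + (y == v).
Proof.
rewrite /degree (eq_bigr (fun e => if e == mkedge x y then (x == v) + (y == v) else 0)).
  rewrite -big_mkcondr /=.
  have [|] := boolP (v \in val (mkedge x y)) => h.
    rewrite (big_pred1 (mkedge x y)) // => e /=.
    by case: eqP => [->|_]; rewrite ?andbF //= h.
  rewrite big1 => [|e /andP [ve /eqP eqe]]; last by rewrite -eqe ve in h.
  move: h; rewrite !inE negb_or !(eq_sym v).
  by case/andP => /negbTE -> /negbTE ->.
move=> e ve; rewrite ffunE /= addn0 (eq_sym (mkedge x y)).
case: eqP => [eqe|_]; last by rewrite mul0n.
move: ve; rewrite eqe eq_mkedge /= !inE !(eq_sym v).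
by case: (x == v); case: (y == v).
Qed.

Lemma degree_mg s v : degree (mg s) v = \sum_(a <- s) ((a.1 == v) + (a.2 == v)).
Proof.
elim: s => [|[x y] s IH].
  by rewrite big_nil /degree big1 // => e _; rewrite ffunE.
rewrite big_cons -IH -degree_edge; apply: degreeD => e.
by rewrite -mg_cat.
Qed.

Lemma size_mg s : \sum_e mg s e = size s.
Proof.
elim: s => [|a s IH]; first by rewrite big1 // => e _; rewrite ffunE.
rewrite -cat1s /= (eq_bigr (fun e => mg [:: a] e + mg s e)) => [|e _]; last first.
  by rewrite -mg_cat.
rewrite big_split /= IH (bigD1 (mkedge a.1 a.2)) //= big1 => [|e ne].
  by rewrite ffunE /= eqxx.
by rewrite ffunE /= eq_sym (negbTE ne).
Qed.

Lemma adj_mg s u v : adj (mg s) u v = ((u, v) \in s) || ((v, u) \in s).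
Proof.
rewrite /adj ffunE -has_count; apply/hasP/orP.
  case=> -[x y] xys /=; rewrite eq_mkedge.
  by case/orP => /andP [/eqP <- /eqP <-]; [left|right].
by case=> h; [exists (u, v)|exists (v, u)]; rewrite // mkedgeC.
Qed.

(* The edges of the walk from x to y with successive inner vertices p. *)
Fixpoint steps x p y : seq (V * V) :=
  if p is z :: p' then (x, z) :: steps z p' y else [:: (x, y)].

Lemma steps_cat x p z q y : steps x (p ++ z :: q) y = steps x p z ++ steps z q y.
Proof. by elim: p x => [|w p IH] x //=; rewrite IH. Qed.

Lemma size_steps x p y : size (steps x p y) = (size p).+1.
Proof. by elim: p x => [|w p IH] x //=; rewrite IH. Qed.

Lemma mem_steps x p y a :
  a \in steps x p y -> (a.1 \in x :: p) /\ (a.2 \in rcons p y).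
Proof.
elim: p x => [|w p IH] x /=; rewrite inE; first by move/eqP=> ->; rewrite !inE /=.
case/orP => [/eqP -> | /IH [h1 h2]]; first by rewrite !inE !eqxx.
by split; rewrite inE ?h1 ?h2 orbT.
Qed.

(** Every inner visit enters and leaves, hence the doubling; so if [x] and [y] differ, exactly these
    two have odd degree. *)
Lemma degree_steps x p y v :
  degree (mg (steps x p y)) v = (x == v) + (y == v) + (count_mem v p).*2.
Proof.
rewrite degree_mg; elim: p x => [|w p IH] x /=.
  by rewrite big_seq1 addn0.
rewrite big_cons IH /= doubleD -(addnn (w == v)) !addnA; congr (_ + _).
by rewrite -!addnA; congr (_ + _); rewrite [RHS]addnC addnA.
Qed.

Lemma connect_steps (e : rel V) x p y z :
  (forall a, a \in steps x p y -> e a.1 a.2) -> z \in x :: p -> connect e x z.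
Proof.
elim: p x => [|w p IH] x h; rewrite inE.
  by move=> /eqP ->; apply: connect0.
case/orP => [/eqP ->|zp]; first exact: connect0.
apply: (@connect_trans _ _ w).
  by apply: connect1; apply: (h (x, w)); rewrite /= inE eqxx.
by apply: IH zp => a ha; apply: h; rewrite /= inE ha orbT.
Qed.

(* A nonempty closed walk is given by its base point and its other vertices in
   order; the closing edge returns to the base point. *)
Notation walk := (V * seq V)%type.
Implicit Types (w : walk) (W : seq walk).
Definition verts w := w.1 :: w.2.
Definition csteps w := steps w.1 w.2 w.1.
Definition wmg W := mg (flatten (map csteps W)).

Lemma wmg_cons w W e : wmg (w :: W) e = mg (csteps w) e + wmg W e.
Proof. exact: mg_cat. Qed.

Lemma degree_wmg_cons w W v :
  degree (wmg (w :: W)) v = (count_mem v (verts w)).*2 + degree (wmg W) v.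
Proof.
by rewrite (degreeD _ (wmg_cons w W)) degree_steps addnn -doubleD.
Qed.

Lemma degree_wmg W v :
  degree (wmg W) v = (count_mem v (flatten (map verts W))).*2.
Proof.
elim: W => [|w W IH]; first by rewrite degree_mg big_nil.
by rewrite degree_wmg_cons IH -doubleD -count_cat.
Qed.

Lemma mem_csteps w a : a \in csteps w -> (a.1 \in verts w) /\ (a.2 \in verts w).
Proof. by case/mem_steps => -> h; rewrite /verts -mem_rcons. Qed.

Lemma adj_wmg W u v :
  adj (wmg W) u v -> exists w, [/\ w \in W, u \in verts w & v \in verts w].
Proof.
by rewrite adj_mg => /orP [] /flatten_mapP [w wW /mem_csteps [h1 h2]]; exists w.
Qed.

Lemma connect_wmg W w v : w \in W -> v \in verts w -> connect (adj (wmg W)) w.1 v.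
Proof.
move=> wW; apply: (@connect_steps _ _ _ w.1) => -[a b] ha; rewrite adj_mg /=.
by apply/orP; left; apply/flatten_mapP; exists w.
Qed.

(** Such a walk meets a depot only at its base point, hence at most once. *)
Lemma count_depot (D : {set V}) W v : v \in D ->
  (forall w, w \in W -> all [predC D] w.2) ->
  count_mem v (flatten (map verts W)) <= count (fun w => v \in verts w) W.
Proof.
move=> vD depotW; rewrite count_flatten -map_comp sumnE big_map -sum1_count.
rewrite [leqRHS]big_mkcond big_seq [leqRHS]big_seq; apply: leq_sum => w wW /=.
rewrite (count_memPn _) ?addn0; last first.
  by apply/negP => /(allP (depotW w wW)); rewrite /= vD.
by case: eqP => // <-; rewrite inE eqxx.
Qed.

(** The same cyclic walk, read from [v] on; edges and vertices are merely permuted. *)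
Lemma rot_walk w v : v \in verts w -> exists p,
  perm_eq (csteps (v, p)) (csteps w) /\ perm_eq (v :: p) (verts w).
Proof.
case: w => x q; rewrite /verts /csteps /= inE => /orP [/eqP ->|]; first by exists q.
case/splitPr => q1 q2; exists (q2 ++ x :: q1).
rewrite !steps_cat perm_catC; split => //.
by rewrite -!cat_cons perm_catC.
Qed.

(** * Vertex-disjoint closed walks and Euler's theorem *)

Definition separated W := forall v, count (fun w => v \in verts w) W <= 1.

Lemma separatedP W w w' v : separated W -> w \in W -> w' \in W ->
  v \in verts w -> v \in verts w' -> w = w'.
Proof.
move=> sepW wW w'W vw vw'; have := sepW v; rewrite -size_filter.
have : w \in filter (fun w => v \in verts w) W by rewrite mem_filter vw.
have : w' \in filter (fun w => v \in verts w) W by rewrite mem_filter vw'.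
by case: filter => [|a [|]] //; rewrite !inE => /eqP -> /eqP ->.
Qed.

(** Every edge of [wmg W] lies on a walk of [W], and only [w] passes through a vertex of [w], so a
    path cannot leave it. *)
Lemma separated_connect W w u v : separated W -> w \in W ->
  connect (adj (wmg W)) u v -> u \in verts w -> v \in verts w.
Proof.
move=> sepW wW /connectP [p pp ->]; elim: p u pp => [|z p IH] u //=.
case/andP => /adj_wmg [w' [w'W uw' zw']] pz uw; apply: IH pz _.
by rewrite (separatedP sepW wW w'W uw uw').
Qed.

Lemma closed_walk_in X x p y : (forall v, ~~ odd (degree X v)) ->
  (forall e, mg (steps x p y) e <= X e) ->
  exists q, forall e, mg (steps x q x) e <= X e.
Proof.
move=> evenX; have [n] := ubnP (\sum_e X e - size p).
elim: n p y => [|n IH] p y //; rewrite ltnS => len sub.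
have [eqyx|neq] := eqVneq y x; first by exists p; rewrite eqyx in sub.
(* Strictness makes the truncated difference drop when the walk grows. *)
have size_p : size p < \sum_e X e.
  by rewrite -(size_steps x p y) -size_mg; apply: leq_sum.
pose Z : multigraph V := [ffun e => X e - mg (steps x p y) e].
have [e ye] : exists2 e : edge V, y \in val e & 0 < Z e.
  apply: degree_gt0; have /(degreeD y) eqdeg e : X e = mg (steps x p y) e + Z e.
    by rewrite [Z e]ffunE subnKC.
  move: (evenX y); rewrite eqdeg degree_steps eqxx (eq_sym x) (negbTE neq).
  by rewrite !oddD odd_double; case: degree.
have [z eqe] := edge_at ye; rewrite ffunE subn_gt0 => Xe.
apply: (IH (rcons p y) z) => [|f].
  by rewrite size_rcons subnSK.
rewrite -cats1 steps_cat mg_cat [X in _ + X]ffunE /= addn0 -eqe.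
by case: eqP => [<-|_]; rewrite ?addn1 // addn0.
Qed.

(** Induction on the number of edges: from any edge [closed_walk_in] produces a closed walk, whose
    removal keeps the degrees even. *)
Lemma closed_walk_decomposition X : (forall v, ~~ odd (degree X v)) ->
  exists W, X = wmg W.
Proof.
have [n] := ubnP (\sum_e X e).
elim: n X => // n IH X; rewrite ltnS => sumX evenX.
have [/forallP X0|] := boolP [forall e, X e == 0].
  by exists [::]; apply/ffunP => e; rewrite ffunE (eqP (X0 e)).
rewrite negb_forall => /existsP [e]; have [x [y eqe]] := edgeP e.
rewrite -lt0n => Xe; have [|q sub] := @closed_walk_in X x [::] y evenX.
  by move=> f; rewrite ffunE /= addn0 -eqe; case: eqP => [<-|].
pose Z : multigraph V := [ffun e => X e - mg (csteps (x, q)) e].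
have eqX f : X f = mg (csteps (x, q)) f + Z f by rewrite [Z f]ffunE subnKC.
have [||W eqZ] := IH Z.
- apply: leq_trans sumX; rewrite (eq_bigr _ (fun f _ => eqX f)) big_split /=.
  by rewrite size_mg size_steps addSn ltnS leq_addl.
- move=> v; move: (evenX v); rewrite (degreeD v eqX) degree_steps addnn.
  by rewrite !oddD !odd_double.
by exists ((x, q) :: W); apply/ffunP => f; rewrite wmg_cons -eqZ eqX.
Qed.

(** Induction on the number of walks: if [w] meets some [w'] of [W], both are rotated to a common
    vertex and spliced into one closed walk, which is inserted into the rest. *)
Lemma separated_insert w W : separated W ->
  exists2 W', separated W' & wmg W' = wmg (w :: W).
Proof.
have [n] := ubnP (size W); elim: n w W => // n IH w W; rewrite ltnS => sizeW sepW.
have [/hasP [w' w'W /hasP [v vw' vw]]|/hasPn disj] :=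
    boolP (has (fun w' => has (mem (verts w)) (verts w')) W); last first.
  exists (w :: W) => // v /=; have [vw|_] := boolP (v \in verts w); last exact: sepW.
  rewrite (_ : count _ W = 0) //; apply/eqP; rewrite -leqn0 leqNgt -has_count.
  apply/hasPn => w' w'W; apply: contra (disj _ w'W) => vw'.
  by apply/hasP; exists v.
have [p [eq_p _]] := rot_walk vw; have [q [eq_q _]] := rot_walk vw'.
have permW := perm_to_rem w'W.
have [||W' sepW' eqW'] := IH (v, p ++ v :: q) (rem w' W).
- by apply: leq_trans sizeW; rewrite (perm_size permW).
- move=> u; apply: leq_trans (sepW u); rewrite (permP permW) /=.
  exact: leq_addl.
exists W' => //; rewrite {}eqW'; apply: perm_mg.
have permf : perm_eq (flatten (map csteps W)) (flatten (map csteps (w' :: rem w' W))).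
  by apply: perm_flatten; apply: perm_map.
rewrite /= /csteps /= steps_cat -catA.
apply: perm_cat; first exact: eq_p.
rewrite (perm_sym _ (flatten _)) (permPl permf) /= perm_cat2r perm_sym; exact: eq_q.
Qed.

(* Euler: each walk of a separated family traverses one nontrivial component. *)
Lemma separated_decomposition X : (forall v, ~~ odd (degree X v)) ->
  exists2 W, separated W & X = wmg W.
Proof.
case/closed_walk_decomposition => W ->; elim: W => [|w W [W1 sep1 eq1]].
  by exists [::].
have [W2 sep2 eq2] := separated_insert w sep1; exists W2 => //.
by rewrite eq2; apply/ffunP => e; rewrite !wmg_cons eq1.
Qed.

(** * Admissible multigraphs and the two problems *)

Definition admissible (D : {set V}) (r : V -> nat) X : bool :=
  [&& [forall v, (v \notin D) ==> (degree X v == (r v).*2)],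
      [forall v, ~~ odd (degree X v)]
    & [forall v, exists d in D, connect (adj X) v d]].

Lemma admissibleP (D : {set V}) r X : reflect
  [/\ meets_requests D r X, (forall v, ~~ odd (degree X v))
    & forall v, exists2 d, d \in D & connect (adj X) v d]
  (admissible D r X).
Proof.
apply: (iffP and3P) => -[h1 h2 h3]; split.
- by move=> v vD; apply/eqP; have /forallP /(_ v) /implyP := h1; apply.
- exact/forallP.
- by move=> v; have /forallP /(_ v) /exists_inP := h3.
- by apply/forallP => v; apply/implyP => vD; apply/eqP; apply: h1.
- exact/forallP.
- by apply/forallP => v; apply/exists_inP.
Qed.

(** A positive request gives the city an edge of some tour; that tour connects it to its depot, also
    inside the sum [X]. *)
Lemma admissible_P7 (D : {set V}) r X :
  (forall v, v \notin D -> 0 < r v) -> P7_feasible D r X -> admissible D r X.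
Proof.
move=> r_gt0 [meetsX [k [S [T [d [_ tourT SD _ eqX]]]]]].
have deg v := degree_sum v eqX.
apply/admissibleP; split => // v.
  rewrite deg; elim/big_ind: _ => // [m n /negbTE om /negbTE on|i _].
    by rewrite oddD om on.
  by case: (tourT i).
have [vD|vD] := boolP (v \in D); first by exists v.
have : 0 < degree X v by rewrite (meetsX v vD) double_gt0 r_gt0.
rewrite deg lt0n sum_nat_eq0 => /forall_inPn [i _]; rewrite -lt0n => Ti.
have [e ve Te] := degree_gt0 Ti; have [_ subS conn _] := tourT i.
have /setIP [diS diD] : d i \in S i :&: D by rewrite SD inE.
exists (d i) => //; have := conn v (d i) (subsetP (subS e Te) v ve) diS.
apply: connect_sub => x y xy; apply: connect1; apply: leq_trans xy _.
by rewrite eqX (bigD1 i) //= leq_addr.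
Qed.

(** The tours are the subgraphs induced on the components. Components are disjoint, so their depots
    differ, and each edge of [X] lies in exactly one of them. *)
Lemma P7_of_P8 (D : {set V}) r X : P8_feasible D r X -> P7_feasible D r X.
Proof.
case=> meetsX cardX compX; split => //.
pose S (i : 'I_#|components X|) := enum_val i.
have SX i : S i \in components X by apply: enum_valP.
have S_inj : injective S by apply: enum_val_inj.
have /all_sig [d SD] (i : 'I_#|components X|) : {d | S i :&: D == [set d]}.
  apply: sigW; have [_ /eqP /cards1P [d ->]] := compX _ (SX i).
  by exists d.
have /and3P [/eqP coverX trivX _] := components_partition X.
have disjX i x : x \in S i -> S i = pblock (components X) x.
  by move=> xS; apply/esym/def_pblock.
exists #|components X|, S, (fun i => induced X (S i)), d; split => //.
- by move=> i; case: (compX _ (SX i)).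
- by move=> i; apply/eqP.
- move=> i j eqd; have dS l : d l \in S l.
    by have /setIP [] : d l \in S l :&: D by rewrite (eqP (SD l)) inE.
  by apply: S_inj; rewrite (disjX i _ (dS i)) (disjX j _ (dS j)) eqd.
- move=> e; have [x [y eqe]] := edgeP e.
  have xX : pblock (components X) x \in components X.
    by apply: pblock_mem; rewrite coverX inE.
  pose i := enum_rank_in xX (pblock (components X) x).
  have Si : S i = pblock (components X) x by apply: enum_rankK_in.
  have xS : x \in S i by rewrite Si mem_pblock coverX inE.
  rewrite (bigD1 i) //= big1 => [|j neq]; rewrite ffunE.
    rewrite addn0; case: ifPn => // nsub; apply/eqP; rewrite -leqn0 leqNgt.
    apply: contra nsub; rewrite eqe => xy; apply/subsetP => w; rewrite !inE.
    by case/orP => /eqP -> //; rewrite -(component_edge (SX i) xy).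
  case: ifP => // /subsetP /(_ x); rewrite eqe !inE eqxx => /(_ isT) xSj.
  by case/eqP: neq; apply: S_inj; rewrite Si -(disjX j x xSj).
Qed.

(** Admissibility gives each component a depot, and the second hypothesis makes it unique. *)
Lemma P8_of_admissible (D : {set V}) r X : admissible D r X ->
  {in D &, forall u v, connect (adj X) u v -> u = v} -> P8_feasible D r X.
Proof.
case/admissibleP => meetsX evenX depotX sepX.
have oneD S : S \in components X -> #|S :&: D| = 1.
  move=> SX; have [x xS defS] := mem_components SX.
  have [d dD xd] := depotX x; apply/eqP/cards1P; exists d.
  apply/setP => y; rewrite !inE; apply/andP/eqP => [[yS yD]|->]; last first.
    by rewrite defS.
  apply: sepX => //; apply: (@connect_trans _ _ x) xd.
  by rewrite connect_adjC -defS.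
split => // [|S SX]; last by split; [apply: component_tour | apply: oneD].
have /and3P [_ trivX _] := components_partition X.
(* Every component is the block of its depot, hence there are at most [#|D|] of them. *)
apply: leq_trans (leq_imset_card (pblock (components X)) (mem D)).
apply/subset_leq_card/subsetP => S SX.
have /eqP/cards1P [d SDd] := oneD S SX.
have /setIP [dS dD] : d \in S :&: D by rewrite SDd inE.
by rewrite -(def_pblock trivX SX dS); apply: imset_f.
Qed.

End Multigraphs.

(** * Shortcutting past depots *)

Section Shortcut.
Variables (R : realFieldType) (V : finType) (c : edge V -> R).
Hypothesis c_triangle : forall u v w : V,
  c (mkedge u w) <= c (mkedge u v) + c (mkedge v w).

Definition steps_cost (s : seq (V * V)) : R := \sum_(a <- s) c (mkedge a.1 a.2).

Lemma cost_mg s : cost c (mg s) = steps_cost s.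
Proof.
rewrite /steps_cost /cost; elim: s => [|a s IH].
  by rewrite big_nil big1 // => e _; rewrite ffunE mul0r.
rewrite big_cons -IH [in RHS](bigD1 (mkedge a.1 a.2)) //= (bigD1 (mkedge a.1 a.2)) //=.
rewrite addrA; congr (_ + _); last first.
  by apply: eq_bigr => e ne; rewrite !ffunE /= eq_sym (negbTE ne).
by rewrite !ffunE /= eqxx natrD mulrDl mul1r.
Qed.

Lemma steps_cost_filter (P : pred V) x p y :
  steps_cost (steps x (filter P p) y) <= steps_cost (steps x p y).
Proof.
rewrite /steps_cost; elim: p x => [|z p IH] x //=.
case: (P z); first by rewrite !big_cons lerD2l.
(* The walk from [z] is handled by induction; one triangle inequality then bypasses [z] towards the
   next kept vertex, or [y] if none is left. With [x = y] this last case yields a loop. *)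
rewrite big_cons; apply: le_trans (lerD (lexx _) (IH z)).
case: (filter P p) => [|w q] /=; first by rewrite !big_seq1 c_triangle.
by rewrite !big_cons addrA lerD2r c_triangle.
Qed.

Lemma perm_steps_cost s t : perm_eq s t -> steps_cost s = steps_cost t.
Proof. exact: perm_big. Qed.

(** The walk is rotated to start at a depot, and all later depot entries are filtered out,
    repetitions of the base point included. *)
Lemma shortcut_walk (D : {set V}) (w : V * seq V) : has (mem D) (verts w) ->
  exists w', [/\ w'.1 \in D, all [predC D] w'.2, {subset verts w' <= verts w},
    {in [predC D], forall v, count_mem v (verts w') = count_mem v (verts w)}
    & steps_cost (csteps w') <= steps_cost (csteps w)].
Proof.
case/hasP => d dw dD; have [p [eq_s eq_p]] := rot_walk dw.
exists (d, filter [predC D] p); split => //=.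
- exact: filter_all.
- move=> v; rewrite -(perm_mem eq_p) !inE => /orP [-> //|].
  by rewrite mem_filter => /andP [_ ->]; rewrite orbT.
- move=> v vD; transitivity (count_mem v (d :: p)); last exact: (permP eq_p).
  rewrite /= count_filter; congr (_ + _)%N.
  by apply: eq_count => u /=; case: eqP => // ->; rewrite (vD : v \notin D).
by rewrite -(perm_steps_cost eq_s); apply: steps_cost_filter.
Qed.

(** The bound on counts is what keeps the family separated. *)
Lemma shortcut_walks (D : {set V}) (W : seq (V * seq V)) :
  (forall w, w \in W -> has (mem D) (verts w)) ->
  exists W', [/\ forall w, w \in W' -> w.1 \in D /\ all [predC D] w.2,
    forall v, (count (fun w => v \in verts w) W' <=
               count (fun w => v \in verts w) W)%N,
    {in [predC D], forall v, degree (wmg W') v = degree (wmg W) v}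
    & cost c (wmg W') <= cost c (wmg W)].
Proof.
elim: W => [|w W IH] hD; first by exists [::]; split.
have [|W' [h1 h2 h3 h4]] := IH.
  by move=> w' w'W; apply: hD; rewrite inE w'W orbT.
have [|w' [k1 k2 k3 k4 k5]] := @shortcut_walk D w.
  by apply: hD; rewrite inE eqxx.
exists (w' :: W'); split.
- by move=> w1; rewrite inE => /orP [/eqP ->|/h1].
- move=> v /=; apply: leq_add (h2 v); case: (boolP (v \in verts w')) => // /k3.
  by move=> ->.
- by move=> v vD; rewrite !degree_wmg_cons k4 ?h3.
- move: h4; rewrite !cost_mg /steps_cost /= !big_cat; exact: lerD.
Qed.

End Shortcut.

(** * Finite search and the common optimum *)

Section Optimum.
Variables (R : realFieldType) (V : finType) (c : edge V -> R).
Variables (D : {set V}) (r : V -> nat).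
Hypothesis c_triangle : forall u v w : V,
  c (mkedge u w) <= c (mkedge u v) + c (mkedge v w).
Hypothesis r_gt0 : forall v : V, v \notin D -> (1 <= r v)%N.

(** A city lies on some walk, which joins it to its base depot. Two distinct connected depots would
    lie on one walk, but its base point is the only depot there. *)
Lemma walks_P8_feasible (W : seq (V * seq V)) : separated W ->
  (forall w, w \in W -> w.1 \in D /\ all [predC D] w.2) ->
  meets_requests D r (wmg W) -> P8_feasible D r (wmg W).
Proof.
move=> sepW depotW meetsW; apply: P8_of_admissible.
  apply/admissibleP; split => // v; first by rewrite degree_wmg odd_double.
  have [vD|vD] := boolP (v \in D); first by exists v; rewrite ?connect0.
  have : (0 < degree (wmg W) v)%N by rewrite (meetsW v vD) double_gt0 r_gt0.
  rewrite degree_wmg double_gt0 -has_count has_pred1 => /flatten_mapP [w wW vw].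
  by exists w.1; [case: (depotW w wW) | rewrite connect_adjC connect_wmg].
move=> u v uD vD uv; have [p path_p lastv] := connectP uv.
case: p path_p lastv => [_ -> //|z p /= /andP [/adj_wmg [w [wW uw _]] _] _].
have vw := separated_connect sepW wW uv uw.
have only x : x \in D -> x \in verts w -> x = w.1.
  move=> xD; rewrite inE => /orP [/eqP //|xw].
  by have [_ /allP /(_ x xw)] := depotW w wW; rewrite /= xD.
by rewrite (only u) // (only v).
Qed.

(** Bounds all multiplicities after shortcutting, by way of degrees: a depot is visited at most
    once, a city [r v] times, and the sum dominates each term. *)
Let N := (\sum_v (maxn 1 (r v)).*2)%N.

Lemma shortcut X : admissible D r X ->
  exists Y, [/\ P8_feasible D r Y, cost c Y <= cost c X & forall e, (Y e <= N)%N].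
Proof.
case/admissibleP => meetsX evenX depotX.
have [W sepW eqX] := separated_decomposition evenX; subst X.
have [|W' [depotW' leW' degW' costW']] := shortcut_walks c_triangle (D := D) (W := W).
  (* The walk [w] covers every vertex connected to its base point, including the depot supplied by
     admissibility. *)
  move=> w wW; have [d dD wd] := depotX w.1; apply/hasP; exists d => //.
  by apply: separated_connect sepW wW wd _; rewrite inE eqxx.
have sepW' : separated W' by move=> v; apply: leq_trans (leW' v) (sepW v).
have meetsW' : meets_requests D r (wmg W').
  by move=> v vD; rewrite /visits degW'; [apply: meetsX|].
exists (wmg W'); split => //; first exact: walks_P8_feasible.
move=> e; have [v [z eqe]] := edgeP e.
have ve : v \in val e by rewrite eqe !inE eqxx.
apply: leq_trans (leq_degree _ ve) _.
rewrite /N (bigD1 v) //=; apply: leq_trans (leq_addr _ _).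
have [vD|vD] := boolP (v \in D); last by rewrite (meetsW' v vD) leq_double leq_maxr.
rewrite degree_wmg leq_double; apply: leq_trans (leq_maxl _ _).
by apply: leq_trans (sepW' v); apply: count_depot vD _ => w /depotW' [].
Qed.

Lemma exists_admissible : (0 < #|D|)%N -> exists X, admissible D r X.
Proof.
case/card_gt0P => d dD.
(* A single closed walk from [d] with [r v] consecutive visits to each city [v]. *)
pose p := flatten [seq nseq (r v) v | v <- enum (~: D)].
pose W := [:: (d, p)].
have degW v : v \notin D -> degree (wmg W) v = (r v).*2.
  move=> vD; rewrite degree_wmg /= cats0 /= (_ : (d == v) = false); last first.
    by apply: contraNF vD => /eqP <-.
  rewrite add0n count_flatten -map_comp sumnE big_map big_enum /=; congr _.*2.
  rewrite (bigD1 v) ?inE //= count_nseq /= eqxx mul1n big1 ?addn0 // => u /andP [_ uv].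
  by rewrite count_nseq /= (negbTE uv).
exists (wmg W); apply/admissibleP; split => // v.
  by rewrite degree_wmg odd_double.
have [vD|vD] := boolP (v \in D); first by exists v.
exists d => //; rewrite connect_adjC; apply: (@connect_wmg _ W (d, p)).
  exact: mem_head.
rewrite inE; apply/orP; right; apply/flatten_mapP; exists v; first by rewrite mem_enum inE.
by rewrite mem_nseq eqxx r_gt0.
Qed.

Lemma exists_minimum_cost_P8 : (0 < #|D|)%N ->
  exists2 Y, P8_feasible D r Y & forall X, admissible D r X -> cost c Y <= cost c X.
Proof.
case/exists_admissible => X0 /shortcut [Y0 [Y0P8 _ Y0N]].
have P8_adm Y : P8_feasible D r Y -> admissible D r Y.
  by move/P7_of_P8; apply: admissible_P7.
(* Functions into ['I_N.+1] make the bounded candidates a finite type; [inord] is faithful only up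
   to [N]. *)
pose graph_of (b : {ffun edge V -> 'I_N.+1}) : multigraph V := [ffun e => b e : nat].
pose box_of (Y : multigraph V) : {ffun edge V -> 'I_N.+1} := [ffun e => inord (Y e)].
have box_ofK (Y : multigraph V) : (forall e, Y e <= N)%N -> graph_of (box_of Y) = Y.
  by move=> YN; apply/ffunP => e; rewrite !ffunE inordK ?ltnS.
have adm0 : admissible D r (graph_of (box_of Y0)) by rewrite box_ofK // P8_adm.
have [b adm_b min_b] := @arg_minP _ _ _ (box_of Y0)
  (fun b => admissible D r (graph_of b)) (fun b => cost c (graph_of b)) adm0.
(* The minimiser is merely admissible; shortcutting it gives feasibility at no extra cost. *)
have [Y [YP8 costY YN]] := shortcut adm_b.
(* An arbitrary [X] need not lie in the box, but its shortcut [Z] does. *)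
exists Y => // X /shortcut [Z [ZP8 costZ ZN]].
apply: le_trans costY (le_trans _ costZ).
by rewrite -(box_ofK Z ZN); apply: min_b; rewrite box_ofK // P8_adm.
Qed.

End Optimum.

Theorem claim2p5 (R : realFieldType) (V : finType) (c : edge V -> R)
    (D : {set V}) (r : V -> nat)
    (c_ge0 : forall e : edge V, 0 <= c e)
    (c_triangle : forall u v w : V,
        c (mkedge u w) <= c (mkedge u v) + c (mkedge v w))
    (c_loop : forall u v : V, u != v -> c (mkedge v v) <= 2 * c (mkedge u v))
    (D_gt0 : (1 <= #|D|)%N)
    (r_gt0 : forall v : V, v \notin D -> (1 <= r v)%N) :
  exists opt : R,
    is_minimum_cost c (P7_feasible D r) opt /\
    is_minimum_cost c (P8_feasible D r) opt.
Proof.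
have [Y YP8 minY] := exists_minimum_cost_P8 c_triangle r_gt0 D_gt0.
(* One [Y] serves both problems: it is feasible for both, and both feasibilities imply
   admissibility, over which [Y] is minimal. *)
exists (cost c Y); split; split.
- by exists Y => //; apply: P7_of_P8.
- by move=> X XP7; apply: minY; apply: admissible_P7 XP7.
- by exists Y.
- by move=> X /P7_of_P8 XP7; apply: minY; apply: admissible_P7 XP7.
Qed.
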